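(* Let $E$ be a finite-dimensional vector space over a field and let $\mathcal{H}$ be a collection of subspaces of $E$. Then $\mathcal{H}$ satisfies (H1), (H2), (H3) if and only if it satisfies (H1), (H2), (H3'), where: (H1) $E\notin\mathcal{H}$; (H2) for all $H_1,H_2\in\mathcal{H}$, if $H_1\subseteq H_2$ then $H_1=H_2$; (H3) for all distinct $H_1,H_2\in\mathcal{H}$ and every $1$-dimensional subspace $x$ of $E$ there exists $H_3\in\mathcal{H}$ with $(H_1\cap H_2)+x\subseteq H_3$; (H3') for all distinct $H_1,H_2\in\mathcal{H}$ and all $1$-dimensional subspaces $x,y$ of $E$ with $x\not\subseteq H_1$, $x\not\subseteq H_2$, $y\subseteq H_1$, $y\not\subseteq H_2$, there exists $H_3\in\mathcal{H}$ with $(H_1\cap H_2)+x\subseteq H_3$ and $y\not\subseteq H_3$. *)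

(* Defs.v *)
From HB Require Import structures.
From mathcomp Require Import all_boot all_order all_algebra.

Set Implicit Arguments.
Unset Strict Implicit.
Unset Printing Implicit Defensive.

Local Open Scope ring_scope.

(* A collection of subspaces is an arbitrary Prop-valued predicate on
   {vspace E}: over an infinite field it need be neither finite nor decidable.
   Equality in {vspace E} coincides with equality of the sets of vectors. *)

Definition axiomH1 (F : fieldType) (E : vectType F)
    (calH : {vspace E} -> Prop) : Prop :=
  ~ calH fullv.

Definition axiomH2 (F : fieldType) (E : vectType F)
    (calH : {vspace E} -> Prop) : Prop :=
  forall H1 H2 : {vspace E}, calH H1 -> calH H2 ->
    (H1 <= H2)%VS -> H1 = H2.

Definition axiomH3 (F : fieldType) (E : vectType F)
    (calH : {vspace E} -> Prop) : Prop :=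
  forall H1 H2 : {vspace E}, calH H1 -> calH H2 -> H1 <> H2 ->
  forall x : {vspace E}, \dim x = 1%N ->
  exists H3 : {vspace E}, calH H3 /\ (H1 :&: H2 + x <= H3)%VS.

Definition axiomH3' (F : fieldType) (E : vectType F)
    (calH : {vspace E} -> Prop) : Prop :=
  forall H1 H2 : {vspace E}, calH H1 -> calH H2 -> H1 <> H2 ->
  forall x y : {vspace E}, \dim x = 1%N -> \dim y = 1%N ->
    ~~ (x <= H1)%VS -> ~~ (x <= H2)%VS ->
    (y <= H1)%VS -> ~~ (y <= H2)%VS ->
  exists H3 : {vspace E},
    [/\ calH H3, (H1 :&: H2 + x <= H3)%VS & ~~ (y <= H3)%VS].

(* Main.v *)
Require Import Defs.
From mathcomp Require Import all_boot all_order all_algebra.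

(** The substance is that (H2) and (H3) imply (H3'), the q-analogue of strong
    circuit elimination for matroids, stated dually for hyperplanes. Induct on
    the codimension of H1 :&: H2. Let H3 contain H1 :&: H2 + x, by (H3). If H3
    also contains y, pick by (H2) a line g in H2 but not in H3, hence not in H1.
    Both of the following pairs have a larger intersection than H1, H2: the
    pair H3, H1 (with y) yields H4 containing H3 :&: H1 + g but not x, and then
    the pair H4, H2 (with g) yields H5 containing H4 :&: H2 + x but not y. *)

Lemma subvPn_line (F : fieldType) (E : vectType F) (U V : {vspace E}) :
  ~~ (U <= V)%VS ->
  exists x : {vspace E}, [/\ \dim x = 1%N, (x <= U)%VS & ~~ (x <= V)%VS].
Proof.
case/subvPn=> u uU uV; exists <[u]>%VS; rewrite -!memvE; split=> //.
by rewrite dim_vline; case: eqP uV => // ->; rewrite mem0v.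
Qed.

Lemma ltn_dimv (F : fieldType) (E : vectType F) (U V x : {vspace E}) :
  (U <= V)%VS -> (x <= V)%VS -> ~~ (x <= U)%VS -> (\dim U < \dim V)%N.
Proof.
move=> sUV sxV; apply: contraNT.
by rewrite (ltn_leqif (dimv_leqif_sup sUV)) negbK; apply: subv_trans.
Qed.

Lemma axiomH2_H3_H3' (F : fieldType) (E : vectType F)
    (calH : {vspace E} -> Prop) :
  axiomH2 calH -> axiomH3 calH -> axiomH3' calH.
Proof.
move=> h2 h3 H1 H2.
have [n] := ubnP (\dim {:E} - \dim (H1 :&: H2))%N.
elim: n H1 H2 => // n IHn H1 H2; rewrite ltnS => le_n hH1 hH2 neq12.
move=> x y dx dy xH1 xH2 yH1 yH2.
have codim_lt (V W z : {vspace E}) : (H1 :&: H2 <= V :&: W)%VS ->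
    (z <= V :&: W)%VS -> ~~ (z <= H1 :&: H2)%VS ->
    (\dim {:E} - \dim (V :&: W) < n)%N.
  move=> sI zI nz; apply: leq_trans le_n.
  have lt_dim := ltn_dimv _ _ _ _ _ sI zI nz.
  (* Subtraction is truncated, so the strict decrease also needs [H1 :&: H2] to have dimension below
     that of [E]. *)
  by apply: ltn_sub2l => //; apply: leq_trans lt_dim (dimvS (subvf _)).
have [H3 [hH3]] := h3 _ _ hH1 hH2 neq12 x dx.
rewrite subv_add => /andP[sI3 xH3].
have [yH3|yH3] := boolP (y <= H3)%VS; last first.
  by exists H3; rewrite subv_add sI3 xH3.
(* If [H2] lay in [H3], (H2) would make them equal, yet [x] lies only in [H3]. *)
have [|g [dg gH2 gH3]] := @subvPn_line _ _ H2 H3.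
  by apply: contra xH2 => /(h2 _ _ hH2 hH3) ->.
have gH1 : ~~ (g <= H1)%VS.
  by apply: contra gH3 => gH1; apply: subv_trans sI3; rewrite subv_cap gH1.
(* Here [g] is the line to add and [x], in [H3] but not in [H1], the line to avoid; [y] makes the
   intersection grow, as it is not in [H2]. *)
have [H4 [hH4]] : exists H4 : {vspace E},
    [/\ calH H4, (H3 :&: H1 + g <= H4)%VS & ~~ (x <= H4)%VS].
  apply: IHn => //; last by move=> e31; rewrite -e31 xH3 in xH1.
  by apply: (codim_lt _ _ y); rewrite ?subv_cap ?sI3 ?capvSl ?yH3 ?yH1.
rewrite subv_add => /andP[sI4 gH4] xH4.
have yH4 : (y <= H4)%VS by apply: subv_trans sI4; rewrite subv_cap yH3.
have sI42 : (H1 :&: H2 <= H4 :&: H2)%VS.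
  by rewrite subv_cap capvSr (subv_trans _ sI4) // subv_cap sI3 capvSl.
(* Now [x], outside [H4] and [H2], can be added and [y], in [H4] but not in [H2], avoided; growth
   comes from [g], which is not in [H1]. *)
have [H5 [hH5]] : exists H5 : {vspace E},
    [/\ calH H5, (H4 :&: H2 + x <= H5)%VS & ~~ (y <= H5)%VS].
  apply: IHn => //; last by move=> e42; rewrite -e42 yH4 in yH2.
  by apply: (codim_lt _ _ g sI42); rewrite subv_cap ?gH4 ?gH2 ?(negPf gH1).
rewrite subv_add => /andP[sI5 xH5] yH5.
by exists H5; rewrite subv_add xH5 (subv_trans sI42 sI5).
Qed.

(** If [x] lies in [H1] or [H2], that subspace itself serves as [H3]. Otherwise (H2) supplies a line
    [y] of [H1] outside [H2], and (H3') applies. *)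
Lemma axiomH2_H3'_H3 (F : fieldType) (E : vectType F)
    (calH : {vspace E} -> Prop) :
  axiomH2 calH -> axiomH3' calH -> axiomH3 calH.
Proof.
move=> h2 h3' H1 H2 hH1 hH2 neq12 x dx.
have [xH1|xH1] := boolP (x <= H1)%VS.
  by exists H1; rewrite subv_add capvSl.
have [xH2|xH2] := boolP (x <= H2)%VS.
  by exists H2; rewrite subv_add capvSr.
have [|y [dy yH1 yH2]] := @subvPn_line _ _ H1 H2.
  by apply/negP => /(h2 _ _ hH1 hH2).
have [H3 [hH3 sH3 _]] := h3' _ _ hH1 hH2 neq12 _ _ dx dy xH1 xH2 yH1 yH2.
by exists H3.
Qed.

Theorem theorem29 (F : fieldType) (E : vectType F)
    (calH : {vspace E} -> Prop) :
  (axiomH1 calH /\ axiomH2 calH /\ axiomH3 calH) <->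
  (axiomH1 calH /\ axiomH2 calH /\ axiomH3' calH).
Proof.
split=> -[h1 [h2 h3]]; split=> //; split=> //.
- exact: axiomH2_H3_H3'.
- exact: axiomH2_H3'_H3.
Qed.
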